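(* Let $q$ be a prime power, $u,v$ non-zero elements of $\mathbb{F}_q$, and set $\theta=\theta(q-1)$, $W=W(q-1)$. Let $\varepsilon$ be the number of zeros of $ux^2+v$ in $\mathbb{F}_q$. Then $$\left|M(q,u,v)-\theta^2(q-1-\varepsilon)\right|\leq \theta^2\left\{2\sqrt{q}\left[W^2-W-\frac12\left(\frac1\theta-1\right)\right]+\varepsilon(W-1)\right\}.$$
   Context: A primitive element of $\mathbb{F}_q$ is a generator of $\mathbb{F}_q^*$. $M(q,u,v)$ is the number of primitive elements $a\in\mathbb{F}_q$ such that $ua+va^{-1}$ is also primitive. $\omega(m)$ is the number of distinct prime divisors of $m$, $W(m)=2^{\omega(m)}$, $\theta(m)=\phi(m)/m$. *)

(* Defs.v *)
From HB Require Import structures.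
From mathcomp Require Import all_boot all_order all_algebra all_field.
Set Implicit Arguments. Unset Strict Implicit. Unset Printing Implicit Defensive.
Import Order.TTheory GRing.Theory Num.Theory.
Local Open Scope ring_scope.

(* A primitive element of the finite field F (with q = #|F|) is a generator
   of the cyclic group F^*, i.e. an element of multiplicative order q - 1,
   i.e. a primitive (q-1)-th root of unity. *)
Definition primitive_elt (F : finFieldType) (a : F) : bool :=
  (#|F|.-1).-primitive_root a.

Definition Mcount (F : finFieldType) (u v : F) : nat :=
  #|[set a : F | primitive_elt a && primitive_elt (u * a + v * a^-1)]|.

Definition omega (m : nat) : nat := size (primes m).

Definition Wfun (m : nat) : nat := (2 ^ omega m)%N.

Definition theta (R : rcfType) (m : nat) : R := (totient m)%:R / m%:R.

Definition eps_count (F : finFieldType) (u v : F) : nat :=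
  #|[set x : F | u * x ^+ 2 + v == 0]|.

(* Main.v *)
(* Write q = #|F|, n = q - 1. The indicator of the primitive elements is
   sum_k c_k chi_k over the characters of F^*, so that M = sum c_j c_k S(j,k)
   with S(j,k) = sum_a chi_j(a) chi_k(ua + v/a), and S(0,0) = n - eps.
   The coefficients satisfy c_0 = theta, sum |c_k|^2 = theta (Parseval) and
   sum |c_k| <= theta W: the indicator is the product over the primes p | n of
   1 - [p-th power], the l1 norm of coefficients is submultiplicative, and each
   factor has norm 2 (1 - 1/p). For k <> 0 the Weil bound |S(j,k)| <= 2 sqrt q
   is elementary: since S(j,k) = sum_a chi_{j-k}(a) chi_k(u a^2 + v), it is zero
   when chi_{j-k} is odd, and otherwise the substitution b = a^2 turns it into a
   sum of at most two Jacobi sums. The Jacobi sums with a trivial character or a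
   trivial product have absolute value 1, which is the saving on the terms
   j = k and j = - k behind the correction (1/theta - 1)/2. *)
Require Import Defs.
From HB Require Import structures.
From mathcomp Require Import all_boot all_order all_algebra all_field.
From mathcomp Require Import cyclic complex ring lra.
Import Order.TTheory GRing.Theory Num.Theory.
Local Open Scope ring_scope.

(** * Fourier coefficients of the coprimality indicator *)

Lemma closed_prim_root_exists (C : numClosedFieldType) (n : nat) :
  (0 < n)%N -> exists z : C, n.-primitive_root z.
Proof.
move=> n_gt0; have [r Dp] := closed_field_poly_normal ('X^n - 1 : {poly C}).
rewrite (monicP _) ?monicXnsubC // scale1r in Dp.
have rn1: all n.-unity_root r by apply/allP=> z; rewrite -root_prod_XsubC -Dp.
have sz_r: (n < (size r).+1)%N.
  by rewrite -(size_prod_XsubC r id) -Dp size_XnsubC.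
have [|z] := hasP (has_prim_root n_gt0 rn1 _ sz_r); last by exists z.
by rewrite -separable_prod_XsubC -Dp separable_Xn_sub_1 // pnatr_eq0 -lt0n.
Qed.

Lemma sum_unity_root (K : fieldType) (n : nat) (w : K) :
  w ^+ n = 1 -> \sum_(k < n) w ^+ k = if w == 1 then n%:R else 0.
Proof.
move=> wn1; case: eqP => [->|/eqP w1].
  by under eq_bigr do rewrite expr1n; rewrite sumr_const card_ord.
have /eqP := subrX1 w n.
by rewrite wn1 subrr eq_sym mulf_eq0 subr_eq0 (negbTE w1) => /eqP.
Qed.

Lemma norm_unity_root (C : numClosedFieldType) (n : nat) (w : C) :
  (0 < n)%N -> w ^+ n = 1 -> `|w| = 1.
Proof.
move=> n_gt0 wn1; apply/eqP; rewrite -(@pexpr_eq1 _ _ n) ?normr_ge0 //.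
by rewrite -normrX wn1 normr1.
Qed.

Section Fourier.

Variables (C : numClosedFieldType) (n : nat) (z : C).
Hypothesis prim_z : n.-primitive_root z.

Let n_gt0 : (0 < n)%N. Proof. exact: prim_order_gt0 prim_z. Qed.
Let n_neq0 : n%:R != 0 :> C. Proof. by rewrite pnatr_eq0 -lt0n. Qed.
Let z_neq0 k : z ^+ k != 0.
Proof. by rewrite expf_neq0 // (prim_root_eq0 prim_z) -lt0n. Qed.

Lemma prim_root_norm k : `|z ^+ k| = 1.
Proof.
by apply: (@norm_unity_root _ n); rewrite // exprAC (prim_expr_order prim_z) expr1n.
Qed.

Lemma prim_root_conj k : (z ^+ k)^* = (z ^+ k)^-1.
Proof. by rewrite invC_norm prim_root_norm expr1n invr1 mul1r. Qed.

Lemma sum_prim_root_div i j :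
  \sum_(k < n) z ^+ (k * i) / z ^+ (k * j) =
  if (i == j %[mod n])%N then n%:R else 0 :> C.
Proof.
under eq_bigr => k _ do rewrite [(k * i)%N]mulnC [(k * j)%N]mulnC !exprM -exprVn -exprMn.
rewrite sum_unity_root ?exprMn ?exprVn.
  by rewrite -(eq_prim_root_expr prim_z) -(inj_eq (mulIf (z_neq0 j))) divfK // mul1r.
by rewrite ![_ ^+ _ ^+ n]exprAC (prim_expr_order prim_z) !expr1n divr1.
Qed.

Definition fourier (f : nat -> C) (k : nat) : C :=
  n%:R^-1 * \sum_(i < n) f i / z ^+ (k * i).

Lemma fourier0 (f : nat -> C) : fourier f 0 = n%:R^-1 * \sum_(i < n) f i.
Proof. by congr (_ * _); apply: eq_bigr => i _; rewrite mul0n divr1. Qed.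

Lemma fourier_inversion (f : nat -> C) (i : 'I_n) :
  f i = \sum_(k < n) fourier f k * z ^+ (k * i).
Proof.
transitivity (\sum_(j < n) f j / n%:R * \sum_(k < n) z ^+ (k * i) / z ^+ (k * j)).
  rewrite (bigD1 i) //= sum_prim_root_div eqxx divfK // big1 ?addr0 // => j.
  rewrite -val_eqE eq_sym => /negbTE ne_ij.
  by rewrite sum_prim_root_div !modn_small // ne_ij mulr0.
under eq_bigr do rewrite mulr_sumr.
rewrite exchange_big /=; apply: eq_bigr => k _.
rewrite /fourier mulr_sumr mulr_suml; apply: eq_bigr => j _; ring.
Qed.

Lemma fourier_parseval (f : nat -> C) :
  \sum_(k < n) `|fourier f k| ^+ 2 = n%:R^-1 * \sum_(i < n) `|f i| ^+ 2.
Proof.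
have conjc k : (fourier f k)^* = n%:R^-1 * \sum_(i < n) (f i)^* * z ^+ (k * i).
  rewrite rmorphM rmorph_sum /= fmorphV rmorph_nat; congr (_ * _).
  by apply: eq_bigr => i _; rewrite rmorphM fmorphV /= prim_root_conj invrK.
under eq_bigr do rewrite normCK conjc mulrCA mulr_sumr.
rewrite -mulr_sumr exchange_big /=; congr (_ * _); apply: eq_bigr => i _.
rewrite normCK mulrC [X in _ = _ * X]fourier_inversion mulr_sumr; apply: eq_bigr => k _; ring.
Qed.

(** For real [f], opposite frequencies carry conjugate coefficients. This later gives the indices
    [k] and [-k] equal weight. *)
Lemma fourier_conj (f : nat -> C) j k :
  (forall i, (f i)^* = f i) -> (n %| j + k)%N -> `|fourier f j| = `|fourier f k|.
Proof.
move=> f_real dvd_n; rewrite -[LHS]norm_conjC; congr `|_|.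
rewrite rmorphM rmorph_sum /= fmorphV rmorph_nat; congr (_ * _).
apply: eq_bigr => i _; rewrite rmorphM fmorphV /= prim_root_conj invrK f_real.
congr (_ * _); apply: (mulIf (z_neq0 (k * i))); rewrite mulVf // -exprD -mulnDl.
by apply/eqP; rewrite -(prim_order_dvd prim_z) dvdn_mulr.
Qed.

(* [f] has an expansion in characters of Z/n with absolute coefficient sum at
   most [B]; repeated frequencies are allowed. *)
Definition l1_expansion (f : nat -> C) (B : C) : Prop :=
  exists2 s : seq (C * nat),
    forall i, f i = \sum_(x <- s) x.1 * z ^+ (x.2 * i) & \sum_(x <- s) `|x.1| <= B.

Lemma l1_expansion1 : l1_expansion (fun=> 1) 1.
Proof. by exists [:: (1, 0%N)] => [i|]; rewrite big_seq1 ?normr1 //= mul1r. Qed.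

Lemma l1_expansionM f g A B :
  l1_expansion f A -> l1_expansion g B -> l1_expansion (fun i => f i * g i) (A * B).
Proof.
move=> [s fE leA] [t gE leB].
exists [seq (x.1 * y.1, (x.2 + y.2)%N) | x <- s, y <- t] => [i|].
  rewrite big_allpairs_dep fE gE mulr_suml; apply: eq_bigr => x _.
  rewrite mulr_sumr; apply: eq_bigr => y _ /=; rewrite mulnDl exprD; ring.
rewrite big_allpairs_dep /=.
under eq_bigr do under eq_bigr do rewrite normrM.
under eq_bigr do rewrite -mulr_sumr.
by rewrite -mulr_suml ler_pM // sumr_ge0.
Qed.

(** [fourier f k] collects the listed coefficients whose frequency is congruent to [k]. Each listed
    term falls in exactly one class, so the triangle inequality suffices. *)
Lemma l1_expansion_fourier f B :
  l1_expansion f B -> \sum_(k < n) `|fourier f k| <= B.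
Proof.
case=> s fE; apply: le_trans.
have fourierE (k : 'I_n) :
    fourier f k = \sum_(x <- s) (if (x.2 == k %[mod n])%N then x.1 else 0).
  rewrite /fourier; under eq_bigr do rewrite fE mulr_suml.
  rewrite exchange_big /= mulr_sumr; apply: eq_bigr => x _.
  under eq_bigr => i _ do rewrite -mulrA [(x.2 * i)%N]mulnC [(k * i)%N]mulnC.
  by rewrite -mulr_sumr sum_prim_root_div; case: ifP; rewrite ?mulr0 // mulrC mulfK.
under eq_bigr do rewrite fourierE.
apply: le_trans.
  by apply: ler_sum => k _; apply: ler_norm_sum.
rewrite exchange_big /=; apply: ler_sum => x _.
have lt_xn : (x.2 %% n < n)%N by rewrite ltn_mod.
rewrite (bigD1 (Ordinal lt_xn)) //= modn_mod eqxx big1 ?addr0 // => k.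
rewrite -val_eqE /= [(k %% n)%N]modn_small // eq_sym => /negbTE->.
exact: normr0.
Qed.

(** The indicator of divisibility by [p] is the average of the [p] characters of order dividing [p].
    In its complement the trivial character has coefficient [1 - 1/p] and the [p - 1] others have
    [-1/p]. *)
Lemma l1_expansion_ndvd p : prime p -> (p %| n)%N ->
  l1_expansion (fun i => (~~ (p %| i)%N)%:R) (2 * (1 - p%:R^-1)).
Proof.
move=> p_pr p_dvd_n; have p_gt0 := prime_gt0 p_pr.
have p_neq0 : p%:R != 0 :> C by rewrite pnatr_eq0 -lt0n.
have iotaE : iota 0 p = index_iota 0 p by rewrite /index_iota subn0.
exists [seq ((k == 0%N)%:R - p%:R^-1, (k * (n %/ p))%N) | k <- iota 0 p] => [i|].
  rewrite big_map /=; under eq_bigr do rewrite mulrBl.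
  rewrite sumrB -mulr_sumr iotaE.
  have -> : \sum_(0 <= k < p) z ^+ (k * (n %/ p) * i) = if (p %| i)%N then p%:R else 0.
    rewrite big_mkord; under eq_bigr do rewrite -mulnA mulnC exprM.
    have prim_w := dvdn_prim_root prim_z p_dvd_n.
    rewrite sum_unity_root exprM -?(prim_order_dvd prim_w) //.
    by rewrite (exprAC _ i) (prim_expr_order prim_w) expr1n.
  rewrite big_ltn // big_nat_cond big1 ?addr0 => [|k /andP[/andP[k_gt0 _] _]]; last first.
    by rewrite -[k]prednK //= mul0r.
  rewrite mul0n mul0n expr0 mul1r; case: ifP => _ /=; last by rewrite mulr0 subr0.
  by rewrite mulVf // subrr.
rewrite big_map /= iotaE big_ltn // eqxx.
rewrite (eq_big_nat _ _ (F2 := fun=> p%:R^-1)) => [|k /andP[k_gt0 _]]; last first.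
  by rewrite -[k]prednK //= sub0r normrN ger0_norm // invr_ge0 ler0n.
rewrite sumr_const_nat ger0_norm ?subr_ge0 ?invf_le1 ?ltr0n ?ler1n //.
by rewrite -[_^-1 *+ _]mulr_natr natrB // mulrBr mulr1 mulVf // mulrDl mul1r.
Qed.


(** * Coprimality to [n]: product over primes and norms of the coefficients *)

Lemma coprime_all_primes i : coprime n i = all (fun p => ~~ (p %| i)%N) (primes n).
Proof.
apply/idP/allP=> [co_ni p|ndvd].
  rewrite mem_primes => /and3P[p_pr _ p_dvd_n]; apply/negP => p_dvd_i.
  have: (p %| gcdn n i)%N by rewrite dvdn_gcd p_dvd_n.
  by rewrite (eqP co_ni) Euclid_dvd1.
apply: contraT; rewrite /coprime => gcd_neq1.
have gcd_gt0 : (0 < gcdn n i)%N by rewrite gcdn_gt0 n_gt0.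
have pdiv_pr : prime (pdiv (gcdn n i)).
  by apply: pdiv_prime; rewrite ltn_neqAle eq_sym gcd_neq1.
have := pdiv_dvd (gcdn n i); rewrite dvdn_gcd => /andP[dvd_n].
by apply/contraLR => _; apply: ndvd; rewrite mem_primes pdiv_pr n_gt0.
Qed.

Lemma totient_ratio :
  (totient n)%:R / n%:R = \prod_(p <- primes n) (1 - p%:R^-1) :> C.
Proof.
rewrite totientE // [in X in _ / X](prod_prime_decomp n_gt0) prime_decompE big_map.
rewrite !natr_prod -prodf_div; apply: eq_big_seq => p.
rewrite mem_primes => /and3P[p_pr _ p_dvd_n].
have log_gt0 : (0 < logn p n)%N by rewrite logn_gt0 mem_primes p_pr n_gt0.
have p_neq0 : p%:R != 0 :> C by rewrite pnatr_eq0 -lt0n prime_gt0.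
rewrite -[in X in _ / X](prednK log_gt0) expnS !natrM natrX -subn1 natrB ?prime_gt0 //.
by field; rewrite p_neq0 expf_neq0.
Qed.

Definition coprime_ind (i : nat) : C := (coprime n i)%:R.

Lemma coprime_ind_l1 :
  l1_expansion coprime_ind ((Wfun n)%:R * ((totient n)%:R / n%:R)).
Proof.
rewrite totient_ratio /Wfun /omega natrX.
have -> : 2%:R ^+ size (primes n) * \prod_(p <- primes n) (1 - p%:R^-1)
    = \prod_(p <- primes n) (2 * (1 - p%:R^-1)) :> C.
  by rewrite big_split /= big_const_seq count_predT iter_mulr_1.
have [s fE leB] : l1_expansion (fun i => (all (fun p => ~~ (p %| i)%N) (primes n))%:R)
    (\prod_(p <- primes n) (2 * (1 - p%:R^-1))).
  have : all (fun p => prime p && (p %| n)%N) (primes n).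
    by apply/allP => p; rewrite mem_primes => /and3P[-> _ ->].
  elim: (primes n) => [|p ps IHps] /=; first by rewrite big_nil => _; apply: l1_expansion1.
  move=> /andP[/andP[p_pr p_dvd_n] /IHps{IHps}].
  rewrite big_cons => /(l1_expansionM _ _ _ _ (l1_expansion_ndvd _ p_pr p_dvd_n)) [s fE leB].
  by exists s => // i; rewrite -fE -natrM mulnb.
by exists s => // i; rewrite -fE /coprime_ind coprime_all_primes.
Qed.

Lemma sum_coprime_ind : n%:R^-1 * \sum_(i < n) coprime_ind i = (totient n)%:R / n%:R.
Proof. by rewrite mulrC totient_count_coprime big_mkord natr_sum. Qed.

Definition pcoef := fourier coprime_ind.

Lemma pcoef0 : pcoef 0 = (totient n)%:R / n%:R.
Proof. by rewrite /pcoef fourier0 sum_coprime_ind. Qed.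

Lemma pcoef_inversion i : coprime_ind i = \sum_(k < n) pcoef k * z ^+ (k * i).
Proof.
have lt_n : (i %% n < n)%N by rewrite ltn_mod.
rewrite /coprime_ind -coprime_modr -[(coprime n _)%:R]/(coprime_ind (Ordinal lt_n)).
rewrite fourier_inversion; apply: eq_bigr => k _ /=.
by rewrite -(prim_expr_mod prim_z) modnMmr (prim_expr_mod prim_z).
Qed.

(** A function with values 0 and 1 equals its square, so Parseval returns its mean. *)
Lemma pcoef_l2 : \sum_(k < n) `|pcoef k| ^+ 2 = (totient n)%:R / n%:R.
Proof.
rewrite fourier_parseval -sum_coprime_ind; congr (_ * _); apply: eq_bigr => i _.
by rewrite /coprime_ind normr_nat -natrX; case: coprime.
Qed.

Lemma pcoef_l1 : \sum_(k < n) `|pcoef k| <= (Wfun n)%:R * ((totient n)%:R / n%:R).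
Proof. exact/l1_expansion_fourier/coprime_ind_l1. Qed.

Lemma pcoef_conj j k : (n %| j + k)%N -> `|pcoef j| = `|pcoef k|.
Proof. by apply: fourier_conj => i; rewrite /coprime_ind conjC_nat. Qed.

End Fourier.

(** * Character sums over a finite field *)

Section CharacterSums.

Variables (C : numClosedFieldType) (F : finFieldType).
Let n := #|F|.-1.
Variables (g : F) (z : C).
Hypotheses (prim_g : n.-primitive_root g) (prim_z : n.-primitive_root z).

Let n_gt0 : (0 < n)%N. Proof. exact: prim_order_gt0 prim_z. Qed.
Let cardF : #|F| = n.+1. Proof. by rewrite prednK // ltnW // finNzRing_gt1. Qed.

Lemma unit_expf_order (a : F) : a != 0 -> a ^+ n = 1.
Proof.
by move=> a_neq0; apply: (mulfI a_neq0); rewrite mulr1 -exprS -cardF expf_card.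
Qed.

(** * Discrete logarithm and multiplicative characters *)

(** At 0, which is not a power of [g], the search returns the default [n]. *)
Definition dlog (a : F) : nat := index a [seq g ^+ i | i <- iota 0 n].

Lemma dlogK a : a != 0 -> g ^+ dlog a = a.
Proof.
move=> a_neq0; have [i def_a] := prim_rootP prim_g (unit_expf_order _ a_neq0).
have a_in : a \in [seq g ^+ i | i <- iota 0 n].
  by apply/mapP; exists (i : nat); rewrite // mem_iota add0n ltn_ord.
have := nth_index 0 a_in; rewrite (nth_map 0%N) ?nth_iota ?add0n //.
  by move: a_in; rewrite -index_mem size_map size_iota.
by move: a_in; rewrite -index_mem size_map.
Qed.

Lemma gX_neq0 i : g ^+ i != 0.
Proof. by rewrite expf_neq0 // (prim_root_eq0 prim_g) -lt0n. Qed.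

(** Every character is extended by 0 at 0, the trivial one included. *)
Definition chi (j : nat) (a : F) : C := if a == 0 then 0 else z ^+ (j * dlog a).

Lemma chi0 j : chi j 0 = 0. Proof. by rewrite /chi eqxx. Qed.

Lemma chi_gX j i : chi j (g ^+ i) = z ^+ (j * i).
Proof.
rewrite /chi (negbTE (gX_neq0 i)); apply/eqP.
rewrite (eq_prim_root_expr prim_z) -modnMmr -[in X in _ == X]modnMmr.
have := dlogK _ (gX_neq0 i); move/eqP; rewrite (eq_prim_root_expr prim_g).
by move/eqP->.
Qed.

Lemma chiM j a b : chi j (a * b) = chi j a * chi j b.
Proof.
have [->|a_neq0] := eqVneq a 0; first by rewrite mul0r chi0 mul0r.
have [->|b_neq0] := eqVneq b 0; first by rewrite mulr0 chi0 mulr0.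
by rewrite -(dlogK a) // -(dlogK b) // -exprD !chi_gX mulnDr exprD.
Qed.

Lemma chiD j k a : chi (j + k) a = chi j a * chi k a.
Proof. by rewrite /chi; case: eqP; rewrite ?mul0r // mulnDl exprD. Qed.

Lemma chi1 j : chi j 1 = 1. Proof. by rewrite -(expr0 g) chi_gX muln0. Qed.

Lemma chi_norm j a : a != 0 -> `|chi j a| = 1.
Proof. by rewrite /chi => /negbTE->; apply: (prim_root_norm _ _ _ prim_z). Qed.

Lemma chi_conj j a : (chi j a)^* = chi j a^-1.
Proof.
have [->|a_neq0] := eqVneq a 0; first by rewrite invr0 chi0 rmorph0.
rewrite -(dlogK a) // chi_gX (prim_root_conj _ _ _ prim_z).
have chi_neq0 : z ^+ (j * dlog a) != 0.
  by rewrite expf_neq0 // (prim_root_eq0 prim_z) -lt0n.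
apply: (mulfI chi_neq0); rewrite divff // -chi_gX -chiM divff ?chi1 //.
exact: gX_neq0.
Qed.

Lemma chi_dvd j a : (n %| j)%N -> chi j a = (a != 0)%:R.
Proof.
rewrite /chi; case: eqP => //= _ dvd_j; apply/eqP.
by rewrite -(prim_order_dvd prim_z) dvdn_mulr.
Qed.

(** Multiplying the variable by [g] permutes the field and scales the sum by [z ^+ j], which differs
    from 1 unless [n] divides [j]. *)
Lemma sum_chi j : \sum_a chi j a = if (n %| j)%N then n%:R else 0.
Proof.
case: ifP => [dvd_j|ndvd_j].
  under eq_bigr do rewrite chi_dvd //.
  rewrite (bigD1 0) //= eqxx add0r; under eq_bigr => a a_neq0 do rewrite a_neq0.
  by rewrite sumr_const cardC1.
have zj_neq1 : z ^+ j != 1 by rewrite -(prim_order_dvd prim_z) ndvd_j.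
have g_neq0 := gX_neq0 1; rewrite expr1 in g_neq0.
have /eqP : \sum_a chi j a = z ^+ j * \sum_a chi j a.
  rewrite {1}(reindex_inj (mulfI g_neq0)) mulr_sumr; apply: eq_bigr => a _.
  by rewrite chiM -{1}(expr1 g) chi_gX muln1.
rewrite -subr_eq0 -{1}[\sum_a _]mul1r -mulrBl mulf_eq0 subr_eq0 eq_sym.
by rewrite (negbTE zj_neq1) => /eqP.
Qed.

Lemma sum_chi_affine j u v : u != 0 ->
  \sum_a chi j (u * a + v) = if (n %| j)%N then n%:R else 0.
Proof.
by move=> u_neq0; rewrite -sum_chi [RHS](reindex_inj (addIr v)) [RHS](reindex_inj (mulfI u_neq0)).
Qed.

(** * Absolute values of Jacobi sums *)

(** The substitution [b = 1/x - 1] turns the quotient [(t b + 1)/(b + 1)] into [t + (1 - t) x],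
    affine in [x]. Only [x = 0] is missing, whence the term [- chi k t]. *)
Lemma sum_chi_ratio k t : ~~ (n %| k)%N ->
  \sum_b chi k (t * b + 1) * (chi k (b + 1))^* = (t == 1)%:R * n.+1%:R - chi k t.
Proof.
move=> ndvd_k.
transitivity (\sum_(x | x != 0) chi k (t + (1 - t) * x)).
  rewrite (reindex_inj (addIr (- 1))) (bigD1 0) //= subrK chi0 rmorph0 mulr0 add0r.
  rewrite [RHS](reindex_inj invr_inj) /=; apply: eq_big => x; rewrite ?invr_eq0 // => x_neq0.
  rewrite subrK chi_conj -chiM; congr (chi k _); field; exact: x_neq0.
rewrite [X in _ = X](_ : _ = \sum_x chi k (t + (1 - t) * x) - chi k t).
  by rewrite [in RHS](bigD1 0) //= mulr0 addr0 addrC addrK.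
congr (_ - _); case: eqP => [->|/eqP t_neq1].
  under eq_bigr do rewrite subrr mul0r addr0 chi1.
  by rewrite mul1r sumr_const cardF.
under eq_bigr do rewrite addrC.
by rewrite sum_chi_affine ?(negbTE ndvd_k) ?mul0r // subr_eq0 eq_sym.
Qed.

(** For nontrivial [chi l], the squared norm is a double sum. Writing one variable as [t b] leaves
    [chi l t] times the sum of [sum_chi_ratio], and orthogonality in [t] concludes. *)
Lemma jacobi_norm l k : ~~ (n %| k)%N ->
  `|\sum_b chi l b * chi k (b + 1)| ^+ 2
     = if (n %| l)%N || (n %| l + k)%N then 1 else n.+1%:R.
Proof.
move=> ndvd_k; have [dvd_l|ndvd_l] /= := boolP (n %| l)%N.
  have /eqP : \sum_b chi k (b + 1) = 0.
    rewrite -[RHS](_ : \sum_b chi k (1 * b + 1) = 0).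
      by apply: eq_bigr => b _; rewrite mul1r.
    by rewrite sum_chi_affine ?oner_neq0 ?(negbTE ndvd_k).
  rewrite (bigD1 0) //= add0r chi1 addrC addr_eq0 => /eqP sum_k.
  rewrite (bigD1 0) //= chi0 mul0r add0r.
  under eq_bigr => b b_neq0 do rewrite chi_dvd // b_neq0 mul1r.
  by rewrite sum_k normrN normr1 expr1n.
rewrite normCK rmorph_sum mulr_sumr /=.
transitivity (\sum_(b | b != 0) \sum_t chi l t * (chi k (t * b + 1) * (chi k (b + 1))^*)).
  rewrite (bigD1 0) //= chi0 mul0r rmorph0 mulr0 add0r; apply: eq_bigr => b b_neq0.
  rewrite mulr_suml (reindex_inj (mulIf b_neq0)); apply: eq_bigr => t _ /=.
  have chi_bb : chi l b * (chi l b)^* = 1 by rewrite chi_conj -chiM divff ?chi1.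
  rewrite chiM rmorphM -[in RHS](mul1r (chi k _ * _)) -chi_bb; ring.
rewrite exchange_big /=.
under eq_bigr => t _.
  rewrite -mulr_sumr.
  (* The excluded value [b = 0] would contribute 1, hence the final [- 1]. *)
  rewrite (_ : \sum_(b | b != 0) _ = (t == 1)%:R * n.+1%:R - chi k t - 1); last first.
    rewrite -sum_chi_ratio // [in RHS](bigD1 0) //= mulr0 add0r chi1 rmorph1 mulr1.
    by rewrite [RHS]addrC addKr.
  rewrite !mulrBr mulr1 -chiD.
  over.
rewrite !sumrB !sum_chi (negbTE ndvd_l) subr0 (bigD1 1) //= eqxx mul1r chi1 mul1r.
rewrite big1 => [|t /negbTE->]; last by rewrite mul0r mulr0.
by case: ifP => _; rewrite addr0 ?subr0 // -natr1 addrC addKr.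
Qed.

Lemma jacobi_affine_norm l k u v : u != 0 -> v != 0 -> ~~ (n %| k)%N ->
  `|\sum_b chi l b * chi k (u * b + v)| ^+ 2
     = if (n %| l)%N || (n %| l + k)%N then 1 else n.+1%:R.
Proof.
move=> u_neq0 v_neq0 ndvd_k; rewrite -jacobi_norm //.
have vu_neq0 : v / u != 0 by rewrite mulf_neq0 ?invr_eq0.
rewrite (reindex_inj (mulfI vu_neq0)) /=.
rewrite (_ : \sum_j _ = chi l (v / u) * chi k v * \sum_b chi l b * chi k (b + 1)).
  by rewrite !normrM !chi_norm // !mul1r.
rewrite mulr_sumr; apply: eq_bigr => b _.
rewrite (_ : u * _ + v = v * (b + 1)); last by field.
rewrite !chiM; ring.
Qed.


Variable s : C.
Hypotheses (s_ge0 : 0 <= s) (s_sqr : s ^+ 2 = n.+1%:R).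

Lemma sqrt_card_ge1 : 1 <= s.
Proof.
rewrite -(@ler_pXn2r _ 2) ?nnegrE ?ler01 // expr1n s_sqr.
by rewrite -natr1 lerDr ler0n.
Qed.

(** The exact absolute value of the Jacobi sum of [chi l] and [chi k] for nontrivial [chi k]. *)
Definition jacobi_bound (k l : nat) : C :=
  if (n %| l)%N || (n %| l + k)%N then 1 else s.

Lemma jacobi_bound_le k l : jacobi_bound k l <= s.
Proof. by rewrite /jacobi_bound; case: ifP => // _; apply: sqrt_card_ge1. Qed.

Variables (u v : F).
Hypotheses (u_neq0 : u != 0) (v_neq0 : v != 0).

Lemma jacobi_affineE k l : ~~ (n %| k)%N ->
  `|\sum_b chi l b * chi k (u * b + v)| = jacobi_bound k l.
Proof.
move=> ndvd_k; apply/eqP; rewrite -(@eqrXn2 _ 2) ?normr_ge0 //; last first.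
  by rewrite /jacobi_bound; case: ifP => // _; apply: ler01.
rewrite jacobi_affine_norm // /jacobi_bound.
by case: ifP => _; rewrite ?expr1n ?s_sqr.
Qed.

(** * Reduction of the mixed sums to Jacobi sums *)

(** Since [chi j 0 = 0], the convention [0^-1 = 0] does not affect this sum. *)
Definition pair_sum (j k : nat) : C := \sum_a chi j a * chi k (u * a + v * a^-1).

(* The index [j + n.-1 * k] stands for [j - k] modulo [n]. *)
Lemma pair_sumE j k :
  pair_sum j k = \sum_a chi (j + n.-1 * k) a * chi k (u * a ^+ 2 + v).
Proof.
apply: eq_bigr => a _; have [->|a_neq0] := eqVneq a 0; first by rewrite !chi0 !mul0r.
have chi_inv : chi k a * chi (n.-1 * k) a = 1.
  by rewrite -chiD -mulSn prednK // chi_dvd ?dvdn_mulr // a_neq0.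
rewrite (_ : u * a ^+ 2 + v = a * (u * a + v * a^-1)); last by field.
rewrite chiM chiD -[in LHS](mulr1 (chi j a)) -chi_inv; ring.
Qed.

Lemma prim_root_half (K : fieldType) (w : K) h :
  n.-primitive_root w -> n = h.*2 -> w ^+ h = -1.
Proof.
move=> prim_w n2h; have h_gt0 : (0 < h)%N by rewrite -double_gt0 -n2h.
have : w ^+ h ^+ 2 == 1 by rewrite -exprM muln2 -n2h (prim_expr_order prim_w).
rewrite sqrf_eq1 -(prim_order_dvd prim_w) => /orP[|/eqP//].
by move/(dvdn_leq h_gt0); rewrite n2h -addnn -[X in (_ <= X)%N]addn0 leq_add2l leqNgt h_gt0.
Qed.

(** The change [a -> -a] preserves [u a^2 + v] and multiplies a character of odd index by its value
    [-1] at [-1], so the sum equals its opposite. *)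
Lemma pair_sum_odd h j k : n = h.*2 -> odd (j + n.-1 * k) -> pair_sum j k = 0.
Proof.
move=> n2h odd_m; rewrite pair_sumE.
have chiN1 : chi (j + n.-1 * k) (-1) = -1.
  rewrite -(prim_root_half _ _ _ prim_g n2h) chi_gX mulnC exprM.
  by rewrite (prim_root_half _ _ _ prim_z n2h) -signr_odd odd_m.
set S := \sum_a _; have : S *+ 2 = 0.
  rewrite mulr2n {1}/S (reindex_inj oppr_inj) -big_split big1 //= => a _.
  by rewrite -[- a]mulN1r chiM chiN1 mulN1r sqrrN !mulN1r !mulNr addNr.
by move/eqP; rewrite mulrn_eq0 => /eqP.
Qed.

(** [chi h] is the quadratic character, so [1 + chi h b] counts the square roots of [b]. *)
Lemma sum_sqr_even h (G : F -> C) : n = h.*2 -> G 0 = 0 ->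
  \sum_a G (a ^+ 2) = \sum_b (1 + chi h b) * G b.
Proof.
move=> n2h G0; rewrite (partition_big (fun a => a ^+ 2) predT) //=.
apply: eq_bigr => b _; have [->|b_neq0] := eqVneq b 0.
  by rewrite G0 mulr0 big1 // => a /eqP->.
under eq_bigr => a /eqP-> do [].
rewrite sumr_const -mulr_natl; congr (_ * _).
have N1_neq1 : -1 != 1 :> F.
  rewrite -(prim_root_half _ _ _ prim_g n2h) -(prim_order_dvd prim_g) n2h gtnNdvd //.
    by rewrite -double_gt0 -n2h.
  by rewrite -addnn -[X in (X < _)%N]addn0 ltn_add2l -double_gt0 -n2h.
have def_b := dlogK b b_neq0; have [odd_i|even_i] := boolP (odd (dlog b)).
  rewrite -def_b chi_gX exprM (prim_root_half _ _ _ prim_z n2h) -signr_odd odd_i subrr.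
  rewrite eq_card0 // => a; rewrite inE; apply/negP => /eqP a_sqr.
  have a_neq0 : a != 0 by apply: contraNneq (gX_neq0 (dlog b)) => a0; rewrite -a_sqr a0 expr0n.
  (* Equal powers of [g] have exponents congruent modulo the even number [n], hence of equal
     parity. *)
  move: a_sqr; rewrite -(dlogK a) // -exprM => /eqP; rewrite (eq_prim_root_expr prim_g).
  rewrite n2h -muln2 => /eqP/(congr1 (modn^~ 2)); rewrite !modn_dvdm ?dvdn_mull //.
  by rewrite modnMl modn2 odd_i.
have [c def_c] : exists2 c, c != 0 & b = c ^+ 2.
  exists (g ^+ (dlog b)./2); first exact: gX_neq0.
  by rewrite -exprM muln2 -[in LHS]def_b -[in LHS](odd_double_half (dlog b)) (negbTE even_i).
move=> ->; rewrite expr2 chiM -chiD addnn -n2h chi_dvd // def_c.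
rewrite (@eq_card _ _ (pred2 c (- c))) => [|a]; last first.
  by rewrite !inE -[LHS]/(a ^+ 2 == c * c) -expr2 eqf_sqr.
have cN : c != - c.
  by rewrite -addr_eq0 -mulr2n -[c *+ 2]mulr_natr mulf_eq0 negb_or def_c addr_eq0 eq_sym.
by rewrite card2 cN.
Qed.

(** The character of index [l.*2] at [a] is [chi l (a ^+ 2)], so the summand depends only on
    [a ^+ 2], and [sum_sqr_even] yields the Jacobi sums of indices [l] and [l + h]. *)
Lemma pair_sum_even h j k l : n = h.*2 -> ~~ (n %| k)%N -> (j + n.-1 * k = l.*2)%N ->
  `|pair_sum j k| <= jacobi_bound k l + jacobi_bound k (l + h).
Proof.
move=> n2h ndvd_k def_m; rewrite pair_sumE def_m -!jacobi_affineE //.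
rewrite (_ : \sum_a _ = \sum_b chi l b * chi k (u * b + v)
                     + \sum_b chi (l + h) b * chi k (u * b + v)); first exact: ler_normD.
rewrite -big_split /=.
under eq_bigr do rewrite -addnn chiD -chiM -expr2.
rewrite (sum_sqr_even h (fun b => chi l b * chi k (u * b + v))) ?chi0 ?mul0r //.
apply: eq_bigr => b _; rewrite chiD; ring.
Qed.

(** For odd [n] one has [-1 = 1] in [F], so squaring is bijective and a single Jacobi sum
    remains. *)
Lemma pair_sum_charP2 j k : odd n -> ~~ (n %| k)%N -> `|pair_sum j k| <= s.
Proof.
move=> odd_n ndvd_k.
have N1E : -1 = 1 :> F.
  have := unit_expf_order (-1); rewrite oppr_eq0 oner_neq0 -signr_odd odd_n => /(_ isT).
  by rewrite expr1.
have sqr_inj : injective (fun a : F => a ^+ 2).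
  move=> a b /= /eqP; rewrite eqf_sqr -[- b]mulN1r N1E mul1r orbb => /eqP //.
have [l def_l] : exists l, forall a, chi (j + n.-1 * k) a = chi l (a ^+ 2).
  (* Adding [n] to an odd index makes it even without changing the character. *)
  set m := (j + _)%N; exists ((m + odd m * n)./2) => a.
  have -> : chi m a = chi (m + odd m * n) a.
    have [->|a_neq0] := eqVneq a 0; first by rewrite !chi0.
    by rewrite chiD (chi_dvd (odd m * n)) ?dvdn_mull // a_neq0 mulr1.
  rewrite expr2 chiM -chiD addnn -[in LHS](odd_double_half (m + _)).
  by rewrite oddD oddM odd_n oddb andbT addbb.
rewrite pair_sumE; under eq_bigr do rewrite def_l.
rewrite (_ : \sum_a _ = \sum_b chi l b * chi k (u * b + v)).
  by rewrite jacobi_affineE ?jacobi_bound_le.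
by rewrite [RHS](reindex_inj sqr_inj).
Qed.


(** * Bounds for the mixed sums and savings at special indices *)

Lemma sqrt_card_le_double : s <= 2 * s.
Proof. by rewrite mulr_natl mulr2n lerDl. Qed.

Lemma dvdn_double_half h x : (h %| x)%N -> (h.*2 %| x)%N || (h.*2 %| x + h)%N.
Proof.
move=> /dvdnP[y ->]; rewrite -mulSnr -muln2 mulnC !(mulnC _ h).
have [->|h_gt0] := posnP h; first by rewrite !mul0n.
rewrite !dvdn_pmul2l // !dvdn2 /=; exact: orbN.
Qed.

(** One of [l] and [l + h] is a trivial index, so one of the two Jacobi sums has absolute value
    1. *)
Lemma jacobi_bound_half_l h k l : n = h.*2 -> (h %| l)%N ->
  jacobi_bound k l + jacobi_bound k (l + h) <= 1 + s.
Proof.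
move=> n2h /dvdn_double_half; rewrite -n2h => /orP[dvd_l|dvd_l].
  by rewrite {1}/jacobi_bound dvd_l lerD2l jacobi_bound_le.
by rewrite addrC {1}/jacobi_bound dvd_l lerD2l jacobi_bound_le.
Qed.

(** Here one of the two products, of indices [l + k] and [l + h + k], is trivial. *)
Lemma jacobi_bound_half_lk h k l : n = h.*2 -> (h %| l + k)%N ->
  jacobi_bound k l + jacobi_bound k (l + h) <= 1 + s.
Proof.
move=> n2h /dvdn_double_half; rewrite -n2h addnAC => /orP[dvd_l|dvd_l].
  by rewrite {1}/jacobi_bound dvd_l orbT lerD2l jacobi_bound_le.
by rewrite addrC {1}/jacobi_bound dvd_l orbT lerD2l jacobi_bound_le.
Qed.

(** The hypotheses make [chi k] the quadratic character: one of the two sums has a trivial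
    character, the other a trivial product. *)
Lemma jacobi_bound_half_both h k l : n = h.*2 -> ~~ (n %| k)%N ->
  (h %| l)%N -> (h %| k)%N -> jacobi_bound k l + jacobi_bound k (l + h) = 2.
Proof.
move=> n2h ndvd_k dvd_l dvd_k.
have := dvdn_double_half _ _ dvd_k; rewrite -n2h (negbTE ndvd_k) /= => dvd_kh.
have := dvdn_double_half _ _ dvd_l; rewrite -n2h => /orP[dvd_n|dvd_n].
  have dvd_lhk : (n %| l + h + k)%N by rewrite -addnA (addnC h k) dvdn_addr.
  by rewrite /jacobi_bound dvd_n dvd_lhk orbT.
have dvd_lk : (n %| l + k)%N.
  by rewrite -(dvdn_addl (l + k) (dvdnn n)) {2}n2h -addnn addnACA dvdn_addr.
by rewrite addrC /jacobi_bound dvd_n dvd_lk orbT.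
Qed.

Lemma pair_sum_le j k : ~~ (n %| k)%N -> `|pair_sum j k| <= 2 * s.
Proof.
move=> ndvd_k; have [odd_n|even_n] := boolP (odd n).
  by apply: le_trans sqrt_card_le_double; apply: pair_sum_charP2.
have n2h : n = (n./2).*2 by rewrite -[LHS](odd_double_half n) (negbTE even_n).
have [odd_m|even_m] := boolP (odd (j + n.-1 * k)).
  by rewrite (pair_sum_odd _ _ _ n2h) // normr0 mulr_ge0.
apply: le_trans (pair_sum_even _ _ _ ((j + n.-1 * k)./2) n2h ndvd_k _) _.
  by rewrite -[LHS]odd_double_half (negbTE even_m).
by rewrite mulr_natl mulr2n lerD ?jacobi_bound_le.
Qed.

(** For [j = k] the index [j - k] is represented by [n * k], whose half [h * k] is a multiple of
    [h]. *)
Lemma pair_sum_diag h k : n = h.*2 -> ~~ (n %| k)%N -> `|pair_sum k k| <= 1 + s.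
Proof.
move=> n2h ndvd_k; apply: le_trans (pair_sum_even h k k (h * k) n2h ndvd_k _) _.
  by rewrite -mulSn prednK // doubleMl -n2h.
by rewrite jacobi_bound_half_l ?dvdn_mulr.
Qed.

Lemma pair_sum_quadratic h k : n = h.*2 -> ~~ (n %| k)%N -> (n %| k + k)%N ->
  `|pair_sum k k| <= 2.
Proof.
move=> n2h ndvd_k dvd_2k; apply: le_trans (pair_sum_even h k k (h * k) n2h ndvd_k _) _.
  by rewrite -mulSn prednK // doubleMl -n2h.
rewrite (jacobi_bound_half_both h) ?dvdn_mulr //.
by move: dvd_2k; rewrite addnn n2h -!muln2 dvdn_pmul2r.
Qed.

Lemma pair_sum_antidiag h j k : n = h.*2 -> ~~ (n %| k)%N -> (n %| j + k)%N ->
  `|pair_sum j k| <= 1 + s.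
Proof.
move=> n2h ndvd_k dvd_jk; set m := (j + n.-1 * k)%N.
(* [m] represents [j - k], so [m + k.*2] represents [j + k]. Halving shows that [h] divides
   [m./2 + k]. *)
have def_m : (m + k.*2 = (j + k) + n * k)%N.
  by rewrite /m -addnn -[in RHS](prednK n_gt0) mulSn; ring.
have dvd_m : (h.*2 %| m + k.*2)%N by rewrite def_m -n2h dvdn_addr ?dvdn_mulr.
have m2l : m = (m./2).*2.
  rewrite -[LHS]odd_double_half; have : (2 %| m + k.*2)%N.
    by apply: dvdn_trans dvd_m; rewrite -mul2n dvdn_mulr.
  by rewrite dvdn2 oddD odd_double addbF => /negbTE->.
apply: le_trans (pair_sum_even _ _ _ m./2 n2h ndvd_k m2l) _.
apply: jacobi_bound_half_lk => //.
by move: dvd_m; rewrite {1}m2l -doubleD -!muln2 dvdn_pmul2r.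
Qed.

(* When [q] is odd the term [j = k] alone saves only [s - 1], one short of the
   required [s]; the equally weighted term [j = - k] makes up for it, and when
   [k = - k] the quadratic character saves more. *)
Lemma weighted_pair_sum_le (x : nat -> C) (k : 'I_n) :
  (forall j, 0 <= x j) -> (forall j, (n %| j + k)%N -> x j = x k) ->
  (~~ odd n -> 2 <= s) -> ~~ (n %| k)%N ->
  \sum_(j < n) x j * `|pair_sum j k| <= 2 * s * (\sum_(j < n) x j) - s * x k.
Proof.
move=> x_ge0 x_opp s_ge2 ndvd_k; rewrite lerBrDr -lerBrDl.
(* It remains to show that the total deficit relative to [2 * s] is at least [s * x k]. Its terms
   are nonnegative, so one or two of them suffice. *)
rewrite mulr_sumr -sumrB.
under [leRHS]eq_bigr => j _ do rewrite (mulrC (2 * s)) -mulrBr.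
have term_ge0 j : 0 <= x j * (2 * s - `|pair_sum j k|).
  by rewrite mulr_ge0 // subr_ge0 pair_sum_le.
rewrite (bigD1 k) //=; have [odd_n|even_n] := boolP (odd n).
  apply: ler_wpDr; first exact: sumr_ge0.
  rewrite mulrC ler_wpM2l // lerBrDr mulr_natl mulr2n lerD2l.
  exact: pair_sum_charP2.
have {}s_ge2 := s_ge2 even_n.
have n2h : n = (n./2).*2 by rewrite -[LHS](odd_double_half n) (negbTE even_n).
have [dvd_2k|ndvd_2k] := boolP (n %| k + k)%N.
  apply: ler_wpDr; first exact: sumr_ge0.
  rewrite mulrC ler_wpM2l // lerBrDr mulr_natl mulr2n lerD2l.
  by apply: le_trans s_ge2; apply: pair_sum_quadratic n2h _ _.
have k_gt0 : (0 < k)%N by rewrite lt0n; apply: contraNneq ndvd_k => ->.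
have lt_nk : (n - k < n)%N by rewrite ltn_subrL k_gt0.
have dvd_nk : (n %| (n - k) + k)%N by rewrite subnK // ltnW.
rewrite (bigD1 (Ordinal lt_nk)) /=; last first.
  by apply: contraNneq ndvd_2k => /(congr1 val) /= nkE; rewrite -{1}nkE.
rewrite addrA; apply: ler_wpDr; first exact: sumr_ge0.
rewrite x_opp // -mulrDr mulrC ler_wpM2l //.
apply: le_trans (_ : (2 * s - (1 + s)) + (2 * s - (1 + s)) <= _); last first.
  rewrite lerD // lerD2l lerN2; first exact: pair_sum_diag n2h _.
  exact: pair_sum_antidiag n2h _ _.
rewrite -subr_ge0 (_ : _ - s = s - 2); last ring.
by rewrite subr_ge0.
Qed.

(** * Mixed sums with a trivial second character *)

(** For [a != 0] the second factor is the indicator of [u a^2 + v != 0], which removes the roots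
    from a complete character sum. *)
Lemma pair_sum_dvdE j k : (n %| k)%N ->
  pair_sum j k = \sum_a chi j a - \sum_(a | u * a ^+ 2 + v == 0) chi j a.
Proof.
move=> dvd_k; rewrite [X in _ = _ - X]big_mkcond /= -sumrB; apply: eq_bigr => a _.
rewrite (chi_dvd k) //; have [->|a_neq0] := eqVneq a 0.
  by rewrite chi0 if_same subr0 mul0r.
rewrite (_ : u * a + v * a^-1 = (u * a ^+ 2 + v) / a); last by field.
rewrite mulf_eq0 invr_eq0 (negbTE a_neq0) orbF.
by case: eqP; rewrite ?mulr0 ?subrr // mulr1 subr0.
Qed.

Lemma pair_sum0 : pair_sum 0 0 = n%:R - (eps_count u v)%:R.
Proof.
rewrite pair_sum_dvdE // sum_chi dvdn0; congr (_ - _).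
rewrite /eps_count -sum1_card natr_sum [RHS](eq_bigl (fun a => u * a ^+ 2 + v == 0)) => [|a].
  apply: eq_bigr => a a_root; rewrite chi_dvd // (_ : a != 0) //.
  by apply: contraTneq a_root => ->; rewrite expr0n mulr0 add0r.
by rewrite inE.
Qed.

Lemma pair_sum_dvd_le j k : ~~ (n %| j)%N -> (n %| k)%N ->
  `|pair_sum j k| <= (eps_count u v)%:R.
Proof.
move=> ndvd_j dvd_k; rewrite pair_sum_dvdE // sum_chi (negbTE ndvd_j) sub0r normrN.
rewrite /eps_count -sum1_card natr_sum [leRHS](eq_bigl (fun a => u * a ^+ 2 + v == 0)) => [|a].
  apply: le_trans (ler_norm_sum _ _ _) _; apply: ler_sum => a _.
  by have [->|a_neq0] := eqVneq a 0; rewrite ?chi0 ?normr0 ?ler01 // chi_norm.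
by rewrite inE.
Qed.


(** * Expansion of the count and estimate over [C] *)

Local Notation c := (pcoef C n z).
Local Notation th := ((totient n)%:R / n%:R : C).

(** [g ^+ i] is primitive exactly when [i] is coprime to [n], so Fourier inversion of [coprime_ind]
    gives the expansion. *)
Lemma primitive_elt_chi a : (primitive_elt a)%:R = \sum_(k < n) c k * chi k a :> C.
Proof.
have [->|a_neq0] := eqVneq a 0.
  rewrite big1 => [|k _]; last by rewrite chi0 mulr0.
  rewrite (_ : primitive_elt (0 : F) = false) //; apply/negP => prim0.
  by have := prim_root_eq0 prim0; rewrite eqxx eqn0Ngt n_gt0.
rewrite -(dlogK a) // /primitive_elt prim_root_exp_coprime // coprime_sym.
rewrite -[LHS]/(coprime_ind C n (dlog a)) (pcoef_inversion _ _ _ prim_z).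
by apply: eq_bigr => k _; rewrite chi_gX.
Qed.

Lemma Mcount_pair_sum :
  (Mcount u v)%:R = \sum_(k < n) c k * \sum_(j < n) c j * pair_sum j k :> C.
Proof.
transitivity (\sum_a (primitive_elt a)%:R * (primitive_elt (u * a + v * a^-1))%:R : C).
  rewrite /Mcount -sum1_card natr_sum.
  rewrite (eq_bigl (fun a => primitive_elt a && primitive_elt (u * a + v * a^-1))).
    by rewrite big_mkcond; apply: eq_bigr => a _; rewrite -natrM mulnb; case: ifP.
  by move=> a; rewrite inE.
under eq_bigr do rewrite !primitive_elt_chi mulr_sumr.
rewrite exchange_big /=; apply: eq_bigr => k _.
under [X in c k * X]eq_bigr do rewrite /pair_sum mulr_sumr.
rewrite exchange_big mulr_sumr /=; apply: eq_bigr => a _.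
rewrite mulr_suml mulr_sumr; apply: eq_bigr => j _; ring.
Qed.

(** The pair [j = k = 0] gives the main term, the other pairs with [k = 0] give the [eps] part, and
    [weighted_pair_sum_le] is summed over [k != 0] with weights [|c k|]. The condition on [s] fails
    only for [q = 3]. *)
Lemma Mcount_bound : (~~ odd n -> 2 <= s) ->
  `|(Mcount u v)%:R - th ^+ 2 * (n%:R - (eps_count u v)%:R)|
    <= th ^+ 2 * (2 * s * ((Wfun n)%:R ^+ 2 - (Wfun n)%:R - 2^-1 * (th^-1 - 1))
                  + (eps_count u v)%:R * ((Wfun n)%:R - 1)).
Proof.
move=> s_ge2; set e : C := (eps_count u v)%:R; set W : C := (Wfun n)%:R.
have th_gt0 : 0 < th by rewrite divr_gt0 ?ltr0n ?totient_gt0.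
have th_ge0 := ltW th_gt0; pose i0 := Ordinal n_gt0.
have [L L_def] : exists L : C, L = \sum_(k < n) `|c k| by eexists.
have c0 : c i0 = th by apply: pcoef0.
have norm_c0 : `|c i0| = th by rewrite c0 ger0_norm.
have ndvd (k : 'I_n) : k != i0 -> ~~ (n %| k)%N.
  by rewrite -val_eqE /= => k_neq0; rewrite gtnNdvd // lt0n.
have L_split : \sum_(k < n | k != i0) `|c k| = L - th.
  by rewrite L_def [in RHS](bigD1 i0) //= norm_c0 [RHS]addrC addKr.
have L_ge : th <= L by rewrite -subr_ge0 -L_split sumr_ge0.
have L_le : L <= W * th by rewrite L_def; apply: (pcoef_l1 _ _ _ prim_z).
have l2_split : \sum_(k < n | k != i0) `|c k| ^+ 2 = th - th ^+ 2.
  by rewrite -[X in X - _](pcoef_l2 _ _ _ prim_z) [in RHS](bigD1 i0) //= norm_c0 [RHS]addrC addKr.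
rewrite Mcount_pair_sum (bigD1 i0) //= (bigD1 i0) //= pair_sum0.
(* [A] collects [j != 0] for [k = 0], and [B] collects [k != 0]. *)
set A := \sum_(j < n | _) _; set B := \sum_(k < n | _) _.
rewrite -/e -[pcoef C n z 0]/(c i0) c0.
rewrite (_ : _ - _ = th * A + B); last by ring.
have A_le : `|th * A| <= th * (e * (L - th)).
  rewrite normrM [X in X * _]ger0_norm // ler_wpM2l //.
  apply: le_trans (ler_norm_sum _ _ _) _; rewrite -L_split mulr_sumr.
  apply: ler_sum => j j_neq0; rewrite normrM mulrC ler_wpM2r //.
  by apply: pair_sum_dvd_le; rewrite ?ndvd.
have B_le : `|B| <= 2 * s * L * (L - th) - s * (th - th ^+ 2).
  apply: le_trans (ler_norm_sum _ _ _) _; rewrite -L_split -l2_split !mulr_sumr -sumrB.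
  apply: ler_sum => k k_neq0.
  rewrite (_ : _ - _ = `|c k| * (2 * s * L - s * `|c k|)); last by ring.
  rewrite normrM ler_wpM2l //; apply: le_trans (ler_norm_sum _ _ _) _.
  under eq_bigr do rewrite normrM.
  rewrite L_def; apply: (weighted_pair_sum_le (fun j => `|c j|)) => [j|j|//|]; rewrite ?ndvd //.
  exact: (pcoef_conj _ _ _ prim_z).
apply: le_trans (ler_normD _ _) _; apply: le_trans (lerD A_le B_le) _.
(* The target is the bound already found with [W * th] in place of [L]; that bound increases with
   [L] for [L >= th]. *)
have -> : th ^+ 2 * (2 * s * (W ^+ 2 - W - 2^-1 * (th^-1 - 1)) + e * (W - 1))
    = th * (e * (W * th - th))
      + (2 * s * (W * th) * (W * th - th) - s * (th - th ^+ 2)).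
  by field; rewrite !pnatr_eq0 -!lt0n ?totient_gt0 n_gt0.
have Lth_ge0 : 0 <= L - th by rewrite subr_ge0.
have L_ge0 : 0 <= L by apply: le_trans th_ge0 L_ge.
have Lth_le : L - th <= W * th - th by rewrite lerD2r.
apply: lerD; first by rewrite !ler_wpM2l ?ler0n.
rewrite lerD2r; apply: ler_pM; rewrite ?mulr_ge0 ?ler_wpM2l ?mulr_ge0 //.
Qed.

End CharacterSums.

(** * The estimate over a real closed field *)

Lemma finField_prim_root_exists (F : finFieldType) :
  exists g : F, (#|F|.-1).-primitive_root g.
Proof.
have n_gt0 : (0 < #|F|.-1)%N by rewrite -subn1 subn_gt0 finNzRing_gt1.
have [|||g _ prim_g] := hasP (@has_prim_root F _ (enum (predC1 (0 : F))) n_gt0 _ _ _).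
- apply/allP => x; rewrite mem_enum /= => x_neq0; apply/unity_rootP.
  apply: (mulfI x_neq0); rewrite mulr1 -exprS prednK ?expf_card //.
  by rewrite ltnW // finNzRing_gt1.
- exact: enum_uniq.
- by rewrite -cardE cardC1.
by exists g.
Qed.

(** The only primitive element of a field with three elements is [-1]. *)
Lemma Mcount_le1 (F : finFieldType) (u v : F) : #|F| = 3 -> (Mcount u v <= 1)%N.
Proof.
move=> card3; rewrite -(cards1 (-1 : F)); apply: subset_leq_card.
apply/subsetP => a; rewrite !inE /primitive_elt card3 /= => /andP[prim_a _].
have := prim_expr_order prim_a => /eqP; rewrite sqrf_eq1 => /orP[/eqP a1|//].
by have := prim_order_dvd prim_a 1; rewrite a1 expr1 eqxx.
Qed.

Theorem theorem6p1 (F : finFieldType) (R : rcfType) (u v : F) :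
  u != 0 -> v != 0 ->
  let q : nat := #|F| in
  let th : R := theta R q.-1 in
  let W : R := (Wfun q.-1)%:R in
  let eps : R := (eps_count u v)%:R in
  `| (Mcount u v)%:R - th ^+ 2 * ((q.-1)%:R - eps) |
    <= th ^+ 2 * (2 * Num.sqrt (q%:R) * (W ^+ 2 - W - 2^-1 * (th^-1 - 1))
                  + eps * (W - 1)).
Proof.
move=> u_neq0 v_neq0; cbv zeta; set q : nat := #|F|.
set th := theta R _; set W : R := (Wfun _)%:R; set eps : R := (eps_count u v)%:R.
have q_gt1 : (1 < q)%N by apply: finNzRing_gt1.
(* For [q = 3] the square root is below 2 and [Mcount_bound] does not apply. There [theta = 1/2] and
   [W = 2], and the count lying between 0 and 1 is enough. *)
have [q3|q_neq3] := eqVneq q 3.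
  have M_le1 : (Mcount u v)%:R <= 1 :> R by rewrite lern1 Mcount_le1.
  have M_ge0 : 0 <= (Mcount u v)%:R :> R by apply: ler0n.
  have eps_ge0 : 0 <= eps by apply: ler0n.
  have sqrt_ge1 : 1 <= Num.sqrt (q%:R) :> R.
    by rewrite -[leLHS]sqrtr1 ler_wsqrtr // ler1n ltnW.
  have thE : th = 2^-1 by rewrite /th /theta q3 /= mul1r.
  have WE : W = 2 by rewrite /W q3.
  rewrite thE WE invrK q3 /= in sqrt_ge1 *.
  rewrite ler_norml; apply/andP; split; nra.
have [g prim_g] := finField_prim_root_exists F.
have n_gt0 : (0 < q.-1)%N by rewrite -subn1 subn_gt0.
have [z prim_z] := closed_prim_root_exists R[i] _ n_gt0.
(* The characters take values in the algebraically closed field [R[i]]; the estimate is pulled back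
   to [R] along this embedding. *)
pose toC : {rmorphism R -> R[i]} := real_complex R.
have s_ge0 : 0 <= toC (Num.sqrt q%:R) by rewrite lecR sqrtr_ge0.
have s_sqr : toC (Num.sqrt q%:R) ^+ 2 = (q.-1).+1%:R.
  by rewrite -rmorphXn sqr_sqrtr ?ler0n // rmorph_nat prednK // ltnW.
(* An odd [q > 1] other than 3 is at least 4. *)
have s_ge2 : ~~ odd q.-1 -> 2 <= toC (Num.sqrt q%:R).
  move=> even_n; rewrite -[2](rmorph_nat toC) lecR.
  rewrite -(@ler_pXn2r _ 2) ?nnegrE ?sqrtr_ge0 ?ler0n // sqr_sqrtr ?ler0n // -natrX ler_nat.
  by move: q_gt1 q_neq3 even_n; case: (q) => [|[|[|[|]]]].
have := Mcount_bound _ _ _ _ prim_g prim_z _ s_ge0 s_sqr _ _ u_neq0 v_neq0 s_ge2.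
have thC : toC th = (totient q.-1)%:R / (q.-1)%:R.
  by rewrite /th /theta rmorphM fmorphV !rmorph_nat.
have normC (x : R) : toC `|x| = `|toC x|.
  by rewrite normc_def /= expr0n addr0 sqrtr_sqr.
rewrite -lecR -2!/(toC _) normC; congr (is_true (`|_| <= _)).
  by rewrite rmorphB rmorphM rmorphXn rmorphB thC !rmorph_nat.
rewrite -[RHS]/(toC _) rmorphM rmorphXn thC rmorphD (rmorphM toC eps) 2!rmorphM.
by rewrite !rmorphB rmorphXn rmorphM rmorphB !fmorphV thC !rmorph_nat rmorph1.
Qed.
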